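(* Let $\eta$ be a composition, let $i<j-1$, and let $\lambda^i,\lambda^j$ be compositions of moduli $|\eta|+i$ and $|\eta|+j$ with $\lambda^i\preceq'\lambda^j$. Then $$E_{\lambda^i}^*(\overline{\lambda^j})=\sum_{\substack{\nu\in D_k(\lambda^i)\\ \nu\preceq'\lambda^j}}\frac{\overline{\nu}_k\,\overline{\lambda^i}_k^{-1}-1}{\overline{\lambda^j}_k\,\overline{\lambda^i}_k^{-1}-1}\;\frac{E_{\lambda^i}^*(\overline{\nu})}{E_\nu^*(\overline{\nu})}\;E^*_\nu(\overline{\lambda^j}),$$ where $k$ is the position of the leftmost component of $\lambda^i$ that does not occur with the same frequency in $\lambda^j$ (i.e. the smallest $k$ such that the number of occurrences of the value $\lambda^i_k$ among the components of $\lambda^i$ differs from its number of occurrences among the components of $\lambda^j$).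
   Context: Fix $n\ge1$ and let $q,t$ be independent indeterminates; all polynomials are in $z=(z_1,\dots,z_n)$ with coefficients in $\mathbb{Q}(q,t)$. A composition is $\eta=(\eta_1,\dots,\eta_n)\in\mathbb{N}^n$ ($0\in\mathbb{N}$), with modulus $|\eta|=\sum_i\eta_i$. Put $l'_\eta(i)=\#\{j<i:\eta_j\ge\eta_i\}+\#\{j>i:\eta_j>\eta_i\}$, $\ \overline{\eta}_i=q^{\eta_i}t^{-l'_\eta(i)}$, $\ \overline{\eta}=(\overline{\eta}_1,\dots,\overline{\eta}_n)$. The interpolation Macdonald polynomial $E^*_\eta(z)=E^*_\eta(z;q,t)$ is the unique polynomial of degree $\le|\eta|$ such that $E^*_\eta(\overline{\mu})=0$ for all compositions $\mu\ne\eta$ with $|\mu|\le|\eta|$, and whose coefficient of $z^\eta=z_1^{\eta_1}\cdots z_n^{\eta_n}$ is $1$; it satisfies $E^*_\eta(\overline{\eta})\ne0$. Successor relation: $\eta\preceq'\lambda$ means there is a permutation $\sigma$ of $\{1,\dots,n\}$ such that $\eta_i<\lambda_{\sigma(i)}$ whenever $i<\sigma(i)$ and $\eta_i\le\lambda_{\sigma(i)}$ whenever $i\ge\sigma(i)$. Operators on compositions: $s_i\eta$ swaps the components $\eta_i$ and $\eta_{i+1}$ ($1\le i\le n-1$), and $\Phi\eta=(\eta_2,\dots,\eta_n,\eta_1+1)$. For $1\le k\le n$ and a set $I_k\subseteq\{1,\dots,n-1\}$ put $D_{I_k}(\eta)=\sigma_k\cdots\sigma_{n-1}\,\Phi\,\sigma_1\cdots\sigma_{k-1}(\eta)$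 (rightmost operator acting first), where $\sigma_j=s_j$ if $j\in I_k$ and $\sigma_j$ is the identity if $j\notin I_k$. Finally $D_k(\lambda^i)=\{\nu:\nu=D_{I_k}(\lambda^i)\text{ for some }I_k\subseteq\{1,\dots,n-1\}\}$.
   Formalization: Added assumption: the denominator λ̄^j_k (λ̄^i_k)^{-1} − 1 is nonzero; it can vanish for the stated k, e.g. n=2, λ^i=(2,0), λ^j=(2,2), k=1, where the displayed formula is undefined. *)

(* Defs.v *)
From mathcomp Require Import all_boot all_order all_fingroup all_algebra.
From mathcomp.multinomials Require Import mpoly.

Set Implicit Arguments.
Unset Strict Implicit.
Unset Printing Implicit Defensive.

Import GRing.Theory.

Local Open Scope ring_scope.

(* The field Q(q,t). *)
Definition Qqt : fieldType := {fraction {mpoly rat[2]}}.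

Definition q : Qqt := tofrac ('X_(ord0 : 'I_2) : {mpoly rat[2]}).
Definition t : Qqt := tofrac ('X_(ord_max : 'I_2) : {mpoly rat[2]}).

(* Compositions of length n are the multi-exponents 'X_{1..n}; the modulus
   of eta is mdeg eta, and the monomial z^eta is 'X_[eta].  Positions are
   elements of 'I_n, hence numbered from 0. *)

Definition leg_colength n (eta : 'X_{1..n}) (i : 'I_n) : nat :=
  (#|[set j : 'I_n | (j < i)%N && (eta i <= eta j)%N]|
   + #|[set j : 'I_n | (i < j)%N && (eta i < eta j)%N]|)%N.

Definition spectral n (eta : 'X_{1..n}) (i : 'I_n) : Qqt :=
  q ^+ eta i * t ^- leg_colength eta i.

(* The conditions characterizing E^*_eta; msize p is 1 + the total degree
   of p (and 0 for p = 0). *)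
Definition is_interpolation_Macdonald n (eta : 'X_{1..n})
    (p : {mpoly Qqt[n]}) : Prop :=
  [/\ (msize p <= (mdeg eta).+1)%N,
      forall mu : 'X_{1..n}, mu <> eta -> (mdeg mu <= mdeg eta)%N ->
        p.@[spectral mu] = 0
    & p@_eta = 1].

Definition preceq' n (eta lam : 'X_{1..n}) : bool :=
  [exists s : {perm 'I_n}, [forall i : 'I_n,
     ((i < s i)%N ==> (eta i < lam (s i))%N)
     && ((s i <= i)%N ==> (eta i <= lam (s i))%N)]].

(* Exchanges the components in positions j and j + 1, so that j : 'I_n ranges
   over all adjacent transpositions of n + 1 positions. *)
Definition swap n (j : 'I_n) (eta : 'X_{1..n.+1}) : 'X_{1..n.+1} :=
  [multinom eta (tperm (widen_ord (leqnSn n) j) (lift ord0 j) i) | i < n.+1].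

(* (eta_1, ..., eta_n) |-> (eta_2, ..., eta_n, eta_1 + 1); ordS is the cyclic
   successor. *)
Definition Phi n (eta : 'X_{1..n}) : 'X_{1..n} :=
  [multinom (eta (ordS i) + (i.+1 == n))%N | i < n].

Definition swap_if n (A : {set 'I_n}) (j : 'I_n) (eta : 'X_{1..n.+1}) :
    'X_{1..n.+1} :=
  if j \in A then swap j eta else eta.

(* With sigma_j = swap_if A j, this is
   sigma_k ... sigma_(n-1) Phi sigma_0 ... sigma_(k-1) eta, the rightmost
   operator acting first (foldr applies the last entry of its list first). *)
Definition DI n (A : {set 'I_n}) (k : 'I_n.+1) (eta : 'X_{1..n.+1}) :
    'X_{1..n.+1} :=
  foldr (swap_if A)
    (Phi (foldr (swap_if A) eta [seq j : 'I_n <- enum 'I_n | (j < k)%N]))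
    [seq j : 'I_n <- enum 'I_n | (k <= j)%N].

(* Duplicate-free: distinct sets A may give the same composition, which must
   be counted once. *)
Definition D n (k : 'I_n.+1) (eta : 'X_{1..n.+1}) : seq 'X_{1..n.+1} :=
  undup [seq DI A k eta | A : {set 'I_n}].

Definition freq n (eta : 'X_{1..n}) (a : nat) : nat :=
  #|[set i : 'I_n | eta i == a]|.

Definition leftmost_freq_diff n (eta lam : 'X_{1..n}) (k : 'I_n) : Prop :=
  freq eta (eta k) <> freq lam (eta k)
  /\ forall l : 'I_n, (l < k)%N -> freq eta (eta l) = freq lam (eta l).

(* Main.v *)
Require Import Defs.
From mathcomp Require Import all_boot all_order all_fingroup all_algebra.
From mathcomp.multinomials Require Import mpoly.
From mathcomp Require Import ring zify.

Set Implicit Arguments.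
Unset Strict Implicit.
Unset Printing Implicit Defensive.

Import GRing.Theory.

Local Open Scope ring_scope.

(** Write X_k = H_k ... H_(n-1) Phi H_1 ... H_(k-1) (positions counted from 1),
    where H_i is the Hecke operator
      H_i f = (t - 1) z_i (f - s_i f) / (z_i - z_(i+1)) + t s_i f
    and (Phi f)(z) = (z_n - t^(1-n)) f(z_n / q, z_1, ..., z_(n-1)).
    The theorem follows from the eigenvalue equation
      X_k E_la = (z_k / la_k - 1) E_la,                                    (1)
    in which la_k stands for the k-th coordinate of the spectral vector.

    Two facts make X_k useful.  First, at spectral vectors each factor acts
    on compositions: the value of H_i f at the vector of mu involves f only at
    the vectors of mu and s_i mu (the total coefficient of s_i f vanishes
    when mu_i = mu_(i+1)), and the value of Phi f at the vector of mu involves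
    only the composition whose image under Phi is mu.  So (X_k f)(mu) != 0
    forces mu = D_I(kappa) for some I and some kappa with f(kappa) != 0; in
    particular X_k raises the modulus by one.  Secondly, X_k f = - f on the
    hyperplane z_k = 0, so that f + X_k f = z_k xi with deg xi <= deg f
    (D_operator).

    For f = E_la the polynomial xi takes the values of E_la / la_k at all
    spectral vectors of modulus at most |la|.  A polynomial of degree at most
    d is determined by its values at the spectral vectors of modulus at most d
    (interpolation_unique), hence xi = E_la / la_k, which is (1)
    (D_eigenfunction).

    Equation (1) has two consequences.
    - Extra vanishing: if E_la does not vanish at mu, then la precedes mu in
      the successor order.  Indeed mu != la differs from la in some spectral
      coordinate k, so by (1) X_k E_la does not vanish at mu, and mu is some
      D_I(kappa) with E_la(kappa) != 0 and |kappa| = |mu| - 1; induct,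
      since kappa precedes D_I(kappa) (extra_vanishing).
    - Expansion: the left side of (1) is supported, among the compositions of
      modulus at most |la| + 1, on D_k(la).  Interpolation on these points
      gives (z_k / la_k - 1) E_la as a combination of the E_nu with nu in
      D_k(la) (linear_pieri).

    Evaluating the expansion at the vector of lambda^j and dropping the terms
    that vanish by extra vanishing gives the formula. *)

(** * Substitution and division for multivariate polynomials *)

Definition subst (F : fieldType) m n (g : 'I_m -> {mpoly F[n]})
  (p : {mpoly F[m]}) : {mpoly F[n]} := p \mPo [tuple g i | i < m].

Lemma meval_subst (F : fieldType) m n (g : 'I_m -> {mpoly F[n]}) p v :
  (subst g p).@[v] = p.@[fun i => (g i).@[v]].
Proof.
by rewrite comp_mpoly_meval; apply: meval_eq => i; rewrite tnth_mktuple.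
Qed.

Lemma substX (F : fieldType) m n (g : 'I_m -> {mpoly F[n]}) i :
  subst g 'X_i = g i.
Proof. by rewrite /subst comp_mpolyXU -tnth_nth tnth_mktuple. Qed.

Lemma subst0 (F : fieldType) m n (g : 'I_m -> {mpoly F[n]}) : subst g 0 = 0.
Proof. exact: comp_mpoly0. Qed.

Lemma substC (F : fieldType) m n (g : 'I_m -> {mpoly F[n]}) c :
  subst g c%:MP = c%:MP.
Proof. exact: comp_mpolyC. Qed.

Lemma substZ (F : fieldType) m n (g : 'I_m -> {mpoly F[n]}) c p :
  subst g (c *: p) = c *: subst g p.
Proof. exact: comp_mpolyZ. Qed.

Lemma subst_id (F : fieldType) n (g : 'I_n -> {mpoly F[n]}) p :
  (forall i, g i = 'X_i) -> subst g p = p.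
Proof.
move=> gX; rewrite -[RHS]comp_mpoly_id /subst.
by congr (p \mPo _); apply: eq_from_tnth => i; rewrite !tnth_mktuple gX.
Qed.

Lemma eq_subst (F : fieldType) m n (g h : 'I_m -> {mpoly F[n]}) p :
  g =1 h -> subst g p = subst h p.
Proof.
move=> gh; rewrite /subst; congr (p \mPo _).
by apply: eq_from_tnth => i; rewrite !tnth_mktuple gh.
Qed.

Lemma msizeD_bound (F : fieldType) n (p p' : {mpoly F[n]}) d :
  (msize p <= d)%N -> (msize p' <= d)%N -> (msize (p + p') <= d)%N.
Proof.
by move=> hp hp'; apply: leq_trans (msizeD_le _ _) _; rewrite geq_max hp hp'.
Qed.

Lemma msizeM_bound (F : fieldType) n (p p' : {mpoly F[n]}) d e :
  (msize p <= d.+1)%N -> (msize p' <= e)%N -> (msize (p * p') <= d + e)%N.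
Proof.
have [->|p0] := eqVneq p 0; first by rewrite mul0r msize0.
have [->|p'0] := eqVneq p' 0; first by rewrite mulr0 msize0.
move=> hp hp'; rewrite msizeM // -subn1 leq_subLR add1n -addSn.
exact: leq_add.
Qed.

(** Reduces to monomials those statements that are linear in the polynomial and
    involve a fixed bound on its degree. *)
Lemma msize_ind (F : fieldType) n (P : {mpoly F[n]} -> Prop) d :
  P 0 -> (forall p p', P p -> P p' -> P (p + p')) ->
  (forall c p, P p -> P (c *: p)) ->
  (forall a : 'X_{1..n}, (mdeg a < d)%N -> P 'X_[a]) ->
  forall p, (msize p <= d)%N -> P p.
Proof.
move=> P0 PD PZ PX p hp; rewrite [p]mpolyE big_seq.
apply: (big_ind P) => // a ap; apply/PZ/PX.
exact: leq_trans (msize_mdeg_lt ap) hp.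
Qed.

Lemma subst_subst (F : fieldType) l m n (g : 'I_l -> {mpoly F[m]})
    (h : 'I_m -> {mpoly F[n]}) p :
  subst h (subst g p) = subst (fun i => subst h (g i)) p.
Proof.
move: (leqnn (msize p)); move: {1 3 4}p.
apply: msize_ind => [|p1 p2 h1 h2|c p1 h1|a _].
- by rewrite /subst !comp_mpoly0.
- by rewrite /subst !comp_mpolyD -!/(subst _ _) h1 h2.
- by rewrite /subst !comp_mpolyZ -!/(subst _ _) h1.
rewrite /subst !comp_mpolyX rmorph_prod /=; apply: eq_bigr => i _.
by rewrite rmorphXn /= !tnth_mktuple.
Qed.

Lemma mnm_succ n (a : 'X_{1..n}) : (0 < mdeg a)%N ->
  exists i b, a = (U_(i) + b)%MM.
Proof.
move=> a0; have /existsP[i hi] : [exists i, 0 < a i]%N.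
  apply: contraLR a0; rewrite negb_exists => /forallP h.
  rewrite -leqNgt leqn0 mdegE sum_nat_eq0.
  by apply/forallP => i; have := h i; rewrite -eqn0Ngt implyTb.
exists i, (a - U_(i))%MM; rewrite addmC submK //.
by apply/mnm_lepP => j; rewrite mnm1E; case: eqP => [<-|].
Qed.

Lemma msize_subst (F : fieldType) m n (g : 'I_m -> {mpoly F[n]}) p d :
  (forall i, msize (g i) <= 2)%N -> (msize p <= d)%N ->
  (msize (subst g p) <= d)%N.
Proof.
move=> g2; move: p; apply: msize_ind => [|p p' hp hp'|c p hp|a].
- by rewrite /subst comp_mpoly0 msize0.
- by rewrite /subst comp_mpolyD msizeD_bound.
- by rewrite /subst comp_mpolyZ (leq_trans (msizeZ_le _ _)).
elim: d a => [|d IHd] a //.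
case: (posnP (mdeg a)) => [/eqP|/mnm_succ[i [b ->]]].
  by rewrite mdeg_eq0 => /eqP-> _; rewrite mpolyX0 /subst comp_mpoly1 msize1.
rewrite mdegD mdeg1 add1n ltnS => hb.
rewrite mpolyXD /subst rmorphM /= -/(subst g 'X_i) substX.
by rewrite -[d.+1]add1n msizeM_bound // IHd.
Qed.

(** Division with remainder by ['X_k - g]: the substitution of [g] for ['X_k] is
    the remainder, because substituting into a product ['X_i * 'X_[b]] changes it by
    a multiple of ['X_k - g].  It serves as a factor theorem for the three
    hyperplanes z_n = t^(1-n), z_i = z_(i+1) and z_k = 0. *)
Lemma mpoly_division (F : fieldType) n (k : 'I_n) (g : {mpoly F[n]}) d p :
  (msize g <= 2)%N -> (msize p <= d.+1)%N ->
  exists2 h, (msize h <= d)%N &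
    p = ('X_k - g) * h + subst (fun i => if i == k then g else 'X_i) p.
Proof.
move=> g2; pose s i := if i == k then g else 'X_i.
have s2 i : (msize (s i) <= 2)%N by rewrite /s; case: ifP; rewrite ?msizeX ?mdeg1.
move: p; apply: msize_ind => [|p p' [h hd hE] [h' hd' hE']|c p [h hd hE]|a].
- by exists 0; rewrite ?msize0 // /subst comp_mpoly0 mulr0 addr0.
- exists (h + h'); first exact: msizeD_bound.
  by rewrite {1}hE {1}hE' /subst comp_mpolyD; ring.
- exists (c *: h); first by rewrite (leq_trans (msizeZ_le _ _)).
  by rewrite {1}hE /subst comp_mpolyZ scalerDr scalerAr.
elim: d a => [|d IHd] a.
  rewrite ltnS leqn0 mdeg_eq0 => /eqP->; exists 0; rewrite ?msize0 //.
  by rewrite mpolyX0 /subst comp_mpoly1 mulr0 add0r.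
case: (posnP (mdeg a)) => [/eqP|/mnm_succ[i [b ->]]].
  rewrite mdeg_eq0 => /eqP-> _; exists 0; rewrite ?msize0 //.
  by rewrite mpolyX0 /subst comp_mpoly1 mulr0 add0r.
rewrite mdegD mdeg1 add1n ltnS => hb.
have [h hd hE] := IHd _ hb.
exists ('X_i * h + (i == k)%:R *: subst s 'X_[b]).
  apply: msizeD_bound.
    by rewrite -[d.+1]add1n msizeM_bound // msizeX mdeg1.
  apply: leq_trans (msizeZ_le _ _) _.
  by apply: msize_subst => //; rewrite msizeX.
rewrite mpolyXD {1}hE /subst rmorphM /= -!/(subst s _) substX.
rewrite [in s i]/s; case: eqP => [->|_]; last by rewrite scale0r; ring.
by rewrite scale1r; ring.
Qed.

(** * Leg colengths under swaps, rotation and extension by zero *)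

(** [leg_colength mu i] counts the [j] that come before [i] when positions are
    sorted by decreasing entry, ties being broken from left to right. *)
Definition above n (mu : 'X_{1..n}) (i j : 'I_n) : bool :=
  (j < i)%N && (mu i <= mu j)%N || (i < j)%N && (mu i < mu j)%N.

Lemma leg_colengthE n (mu : 'X_{1..n}) i :
  leg_colength mu i = #|[pred j | above mu i j]|.
Proof.
rewrite /leg_colength -cardsUI addnC (_ : _ :&: _ = set0) ?cards0 ?add0n.
  by apply: eq_card => j; rewrite !inE.
by apply/setP => j; rewrite !inE; case: ltngtP => //; rewrite ?andbF.
Qed.

Lemma leg_colength_reindex m n (mu : 'X_{1..m}) (nu : 'X_{1..n})
    (f : 'I_n -> 'I_m) (i : 'I_n) :
  bijective f ->
  (forall j, above nu i j = above mu (f i) (f j)) ->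
  leg_colength nu i = leg_colength mu (f i).
Proof.
move=> fb fE; rewrite !leg_colengthE -!sum1_card.
rewrite [RHS](reindex f) /=; last exact: onW_bij.
by apply: eq_bigl => j; rewrite !inE fE.
Qed.

Section AdjacentSwap.
Variables (n : nat) (j : 'I_n).

Definition left_pos : 'I_n.+1 := widen_ord (leqnSn n) j.
Definition right_pos : 'I_n.+1 := lift ord0 j.
Definition adj : 'I_n.+1 -> 'I_n.+1 := tperm left_pos right_pos.

Lemma adjK : involutive adj.
Proof. exact: tpermK. Qed.

Lemma adj_right : adj right_pos = left_pos. Proof. exact: tpermR. Qed.

Variant adj_spec (i : 'I_n.+1) : 'I_n.+1 -> Prop :=
| AdjLeft of i = left_pos : adj_spec i right_pos
| AdjRight of i = right_pos : adj_spec i left_pos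
| AdjOther of i != j :> nat & i != j.+1 :> nat : adj_spec i i.

Lemma adjP i : adj_spec i (adj i).
Proof. by rewrite /adj; case: tpermP => [||/eqP+ /eqP+]; constructor. Qed.

Lemma swapE (mu : 'X_{1..n.+1}) i : swap j mu i = mu (adj i).
Proof. by rewrite mnmE. Qed.

Lemma swapK : involutive (@swap n j).
Proof. by move=> mu; apply/mnmP => i; rewrite !swapE adjK. Qed.

Lemma mdeg_swap mu : mdeg (swap j mu) = mdeg mu.
Proof.
rewrite !mdegE [RHS](reindex adj) /=; last exact/onW_bij/inv_bij/adjK.
by apply: eq_bigr => i _; rewrite swapE.
Qed.

(** Unequal adjacent entries can be exchanged without changing the sorting order;
    for equal entries this fails, which is [leg_colength_plateau]. *)
Lemma leg_colength_swap (mu : 'X_{1..n.+1}) i : mu left_pos != mu right_pos ->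
  leg_colength (swap j mu) i = leg_colength mu (adj i).
Proof.
move=> ne; apply: leg_colength_reindex => [|p]; first exact/inv_bij/adjK.
rewrite /above !swapE.
case: (adjP i) => [->|->|i1 i2]; case: (adjP p) => [->|->|p1 p2] //=;
  rewrite ?ltnn // /bump /=; lia.
Qed.

Lemma leg_colength_plateau (mu : 'X_{1..n.+1}) : mu left_pos = mu right_pos ->
  leg_colength mu right_pos = (leg_colength mu left_pos).+1.
Proof.
move=> eqm; rewrite !leg_colengthE -[RHS]add1n [LHS](cardD1 left_pos); congr (_ + _)%N.
  by rewrite inE /= /above /= eqm leqnn /bump /= add1n ltnS leqnn.
apply: eq_card => i; rewrite !inE /above eqm.
have [->|ir] := eqVneq i right_pos; first by rewrite !ltnn /= /bump /= add1n; lia.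
have [->|il] := eqVneq i left_pos; first by rewrite !ltnn.
have : i != j.+1 :> nat by [].
have : i != j :> nat by [].
rewrite /= /bump /=; lia.
Qed.

End AdjacentSwap.

Lemma mdeg_Phi n (mu : 'X_{1..n.+1}) : mdeg (Phi mu) = (mdeg mu).+1.
Proof.
rewrite !mdegE [in RHS](reindex (@ordS n.+1)) /=; last exact/onW_bij/ordS_bij.
under eq_bigr => i _ do rewrite mnmE.
rewrite big_split /= -[RHS]addn1; congr (_ + _)%N.
rewrite (bigD1 ord_max) //= eqxx big1 // => i.
by rewrite -val_eqE /= eqSS => /negbTE->.
Qed.

Lemma ordS_val n (i : 'I_n.+1) :
  ordS i = (if i == n :> nat then 0 else i.+1) :> nat.
Proof.
rewrite /=; case: eqP => [->|/eqP h]; first by rewrite modnn.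
by rewrite modn_small // ltnS ltn_neqAle h -ltnS ltn_ord.
Qed.

(** The entry that moves from the first to the last place loses its priority in
    ties, but gains one unit, so the sorting order is the same. *)
Lemma leg_colength_Phi n (mu : 'X_{1..n.+1}) i :
  leg_colength (Phi mu) i = leg_colength mu (ordS i).
Proof.
apply: leg_colength_reindex => [|p]; first exact: ordS_bij.
rewrite /above !mnmE !eqSS !ordS_val.
have := ltn_ord i; have := ltn_ord p.
case: (eqVneq (i : nat) n) => [hi|hi]; case: (eqVneq (p : nat) n) => [hp|hp] /=;
  lia.
Qed.

Lemma PhiP n (mu : 'X_{1..n.+1}) : (0 < mu ord_max)%N ->
  exists eta, mu = Phi eta.
Proof.
move=> h; exists [multinom (mu (ord_pred i) - (ord_pred i == ord_max))%N | i < n.+1].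
apply/mnmP => i; rewrite !mnmE ordSK eqSS -val_eqE /=.
case: (eqVneq (i : nat) n) => [hi|_]; last by rewrite subn0 addn0.
by rewrite subnK // (_ : i = ord_max) //; apply: val_inj.
Qed.

Lemma leg_colength_last0 n (mu : 'X_{1..n.+1}) :
  mu ord_max = 0%N -> leg_colength mu ord_max = n.
Proof.
move=> h; rewrite leg_colengthE -[RHS](card_ord n) -[RHS](card_codom (@lift_inj _ ord_max)).
apply: eq_card => i; rewrite !inE; transitivity (i < n)%N.
  by have := ltn_ord i; rewrite /above h /=; lia.
apply/idP/codomP => [hi|[x ->]]; last by rewrite lift_max.
by case: (unliftP ord_max i) hi => [x ->|->]; [exists x|rewrite ltnn].
Qed.

(** A final zero leaves the other leg colengths unchanged, so these compositions
    allow induction on the number of variables. *)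
Definition rcons0 n (mu : 'X_{1..n}) : 'X_{1..n.+1} :=
  [multinom (if unlift ord_max i is Some j then mu j else 0%N) | i < n.+1].

Lemma rcons0_last n (mu : 'X_{1..n}) : rcons0 mu ord_max = 0%N.
Proof. by rewrite mnmE unlift_none. Qed.

Lemma rcons0_lift n (mu : 'X_{1..n}) j : rcons0 mu (lift ord_max j) = mu j.
Proof. by rewrite mnmE liftK. Qed.

Lemma mdeg_rcons0 n (mu : 'X_{1..n}) : mdeg (rcons0 mu) = mdeg mu.
Proof.
rewrite !mdegE big_ord_recr /= rcons0_last addn0.
apply: eq_bigr => i _; rewrite -[RHS]rcons0_lift; congr (rcons0 mu _).
by apply: val_inj; rewrite /= /bump leqNgt ltn_ord.
Qed.

Lemma leg_colength_rcons0 n (mu : 'X_{1..n}) j :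
  leg_colength (rcons0 mu) (lift ord_max j) = leg_colength mu j.
Proof.
rewrite !leg_colengthE -[RHS](card_image (@lift_inj _ ord_max)).
apply: eq_card => p; rewrite !inE.
case: (unliftP ord_max p) => [x ->|->].
  by rewrite mem_image ?inE /above ?rcons0_lift ?lift_max //; exact: lift_inj.
transitivity false; last first.
  symmetry; apply/negbTE/imageP => -[x _] /eqP.
  by rewrite (negbTE (neq_lift _ _)).
rewrite /above rcons0_lift rcons0_last lift_max /=.
by rewrite ltn0 andbF orbF ltnNge (ltnW (ltn_ord j)).
Qed.

(** * The compositions D_I(eta) and the successor order *)

Lemma eq_foldr_swap n (A B : {set 'I_n}) mu l : {in l, A =i B} ->
  foldr (swap_if A) mu l = foldr (swap_if B) mu l.
Proof.
elim: l => //= j l IHl AB; rewrite IHl => [|i il]; last by rewrite AB ?inE ?il ?orbT.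
by rewrite /swap_if AB ?inE ?eqxx.
Qed.

Lemma mdeg_foldr_swap n (A : {set 'I_n}) mu l :
  mdeg (foldr (swap_if A) mu l) = mdeg mu.
Proof. by elim: l => //= j l IHl; rewrite /swap_if; case: ifP; rewrite ?mdeg_swap. Qed.

Lemma mdeg_DI n (A : {set 'I_n}) k mu : mdeg (DI A k mu) = (mdeg mu).+1.
Proof. by rewrite /DI mdeg_foldr_swap mdeg_Phi mdeg_foldr_swap. Qed.

Lemma mem_D n k (mu nu : 'X_{1..n.+1}) :
  reflect (exists A, nu = DI A k mu) (nu \in D k mu).
Proof.
rewrite mem_undup; apply: (iffP imageP) => [[A _ ->]|[A ->]]; first by exists A.
by exists A.
Qed.

Lemma positions_below n (k : 'I_n.+1) :
  map val [seq j : 'I_n <- enum 'I_n | (j < k)%N] = iota 0 k.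
Proof.
rewrite -(filter_map val (fun i => i < k)%N) val_enum_ord.
by rewrite -[RHS](@filter_iota_ltn 0 n) ?add0n // -ltnS.
Qed.

Lemma positions_above n (k : 'I_n.+1) :
  map val [seq j : 'I_n <- enum 'I_n | (k <= j)%N] = iota k (n - k).
Proof.
rewrite -(filter_map val (fun i => k <= i)%N) val_enum_ord.
have kn : (k <= n)%N by rewrite -ltnS.
have -> : iota 0 n = iota 0 k ++ iota k (n - k).
  by have := iotaD 0 k (n - k); rewrite subnKC.
rewrite filter_cat.
rewrite (eq_in_filter (a2 := pred0)) => [|i]; last first.
  by rewrite mem_iota add0n => /andP[_ ik]; rewrite leqNgt ik.
rewrite filter_pred0 (eq_in_filter (a2 := predT)) ?filter_predT // => i.
by rewrite mem_iota => /andP[->].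
Qed.

Lemma preceq'_refl n (mu : 'X_{1..n}) : preceq' mu mu.
Proof.
apply/existsP; exists 1%g; apply/forallP => i.
by rewrite perm1 ltnn !leqnn.
Qed.

Lemma preceq'_trans n (la mu nu : 'X_{1..n}) :
  preceq' la mu -> preceq' mu nu -> preceq' la nu.
Proof.
move=> /existsP[s /forallP sP] /existsP[u /forallP uP].
apply/existsP; exists (s * u)%g; apply/forallP => i; rewrite permM.
have /andP[/implyP s1 /implyP s2] := sP i.
have /andP[/implyP u1 /implyP u2] := uP (s i).
case: (ltnP i (s i)) s1 s2 => si s1 s2; case: (ltnP (s i) (u (s i))) u1 u2 => ui u1 u2;
  apply/andP; split; apply/implyP => h; move: s1 s2 u1 u2 => /=; lia.
Qed.

(** Since the last transposition acts first, an entry may travel left any distance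
    but right at most one place, and only from a position in the range [a, a + m). *)
Lemma foldr_swap_perm n (A : {set 'I_n}) (mu : 'X_{1..n.+1}) l a m :
  map val l = iota a m ->
  exists s : {perm 'I_n.+1}, forall i : 'I_n.+1,
    [/\ foldr (swap_if A) mu l (s i) = mu i,
        (i < a)%N -> s i = i, (s i <= i.+1)%N
      & (a + m <= i)%N -> (s i <= i)%N].
Proof.
elim: l a m => [|j l IHl] a [|m] //=.
  by move=> _; exists 1%g => i; rewrite perm1; split.
case=> ja /IHl[s sP].
exists (if j \in A then s * tperm (left_pos j) (right_pos j) else s)%g => i.
have [s1 s2 s3 s4] := sP i; rewrite addnS -addSn /swap_if.
case: ifP => _; last by split=> // ia; apply/s2/ltnW.
rewrite permM -/(adj j (s i)) swapE adjK; case: adjP => [e|e|n1 n2].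
- have ia : i = left_pos j.
    apply: (@perm_inj _ s); rewrite e; have [_ -> //] := sP (left_pos j).
    by rewrite /= -ja.
  have iv : i = j :> nat by rewrite ia.
  split=> [|h||h]; first exact: s1.
  - by move: h; rewrite iv -ja ltnn.
  - by rewrite iv /= /bump.
  - by move: h; rewrite iv -ja addSn ltnNge leq_addr.
- have ev : s i = j.+1 :> nat by rewrite e.
  split=> [|h||h]; first exact: s1.
  - have := congr1 val (s2 (ltnW h)); rewrite /= ev => iv.
    by move: h; rewrite -iv -ja ltnNge leqnSn.
  - by rewrite /= -ltnS -ev ltnW.
  - by rewrite /= -ltnS -ev ltnW // ltnS s4.
- by split=> // ia; apply/s2/ltnW.
Qed.

(** Phi moves every entry one place left, which makes up for the single step to the
    right permitted by [foldr_swap_perm].  No entry takes such a step twice: one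
    that does so before Phi lands left of position [k], out of reach of the swaps
    after Phi.  The only entry that can end further right is the one that Phi
    increases. *)
Lemma preceq'_DI n (A : {set 'I_n}) k (mu : 'X_{1..n.+1}) : preceq' mu (DI A k mu).
Proof.
rewrite /DI; set nu := foldr _ mu _.
have [s sP] := foldr_swap_perm A mu (positions_below k).
have [u uP] := foldr_swap_perm A (Phi nu) (positions_above k).
have rot_inj : injective (@ord_pred n.+1) by exact: ord_pred_inj.
apply/existsP; exists (s * perm rot_inj * u)%g; apply/forallP => i.
rewrite !permM permE.
have [s1 s2 s3 s4] := sP i; have [-> u2 u3 u4] := uP (ord_pred (s i)).
rewrite -/nu in s1; rewrite mnmE ord_predK s1 eqSS.
have := ordS_val (ord_pred (s i)); rewrite ord_predK.
have kn := ltn_ord k; have pn := ltn_ord (ord_pred (s i)).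
move: u2 u3 u4; set p := ord_pred _ => u2 u3 u4.
have u2' : (p < k)%N -> u p = p :> nat by move=> /u2->.
case: eqP => [_|_] /= sp.
  by rewrite addn1 ltnS leqnn leqnSn !implybT.
rewrite addn0 leqnn implybT andbT; apply/implyP.
rewrite add0n in s4; case: (ltnP p k) => pk.
  by move: s3; rewrite u2' // sp ltnS [(i < p)%N]ltnNge => ->.
have ki : (k <= i)%N by rewrite (leq_trans pk) // -ltnS -sp.
by rewrite ltnNge (leq_trans u3) // -sp s4.
Qed.

(** * Spectral vectors and uniqueness of interpolation *)

(** The two parameters may be any elements of a field that are multiplicatively
    independent in the sense of [indep]; this forces both to be nonzero. *)
Section GenericParameters.
Variables (K : fieldType) (q t : K).
Hypothesis indep :
  forall a b c d, q ^+ a * t ^- b = q ^+ c * t ^- d -> a = c /\ b = d.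

Lemma q_neq0 : q != 0.
Proof.
apply/eqP => q0; have := @indep 1 0 2 0.
by rewrite q0 expr1 expr2 !mul0r => /(_ erefl)[].
Qed.

Lemma t_neq0 : t != 0.
Proof.
apply/eqP => t0; have := @indep 0 1 0 2.
by rewrite t0 expr1 expr2 mul0r => /(_ erefl)[].
Qed.

Definition spec n (mu : 'X_{1..n}) (i : 'I_n) : K :=
  q ^+ mu i * t ^- leg_colength mu i.

Lemma spec_neq0 n (mu : 'X_{1..n}) i : spec mu i != 0.
Proof. by rewrite mulf_neq0 ?invr_neq0 ?expf_neq0 ?q_neq0 ?t_neq0. Qed.

Lemma spec_exp n (mu nu : 'X_{1..n}) i j : spec mu i = spec nu j -> mu i = nu j.
Proof. by case/indep. Qed.

Lemma spec_inj n (mu nu : 'X_{1..n}) : spec mu =1 spec nu -> mu = nu.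
Proof. by move=> h; apply/mnmP => i; apply: spec_exp (h i). Qed.

Lemma spec_swap n (j : 'I_n) (mu : 'X_{1..n.+1}) : mu (left_pos j) != mu (right_pos j) ->
  spec (swap j mu) =1 fun i => spec mu (adj j i).
Proof. by move=> ne i; rewrite /spec leg_colength_swap // swapE. Qed.

(** This relation kills the coefficient z_i - t z_(i+1) of s_i f in H_i f exactly at the
    points where s_i does not permute spectral vectors. *)
Lemma spec_plateau n (j : 'I_n) (mu : 'X_{1..n.+1}) : mu (left_pos j) = mu (right_pos j) ->
  spec mu (left_pos j) = t * spec mu (right_pos j).
Proof.
move=> eqm; rewrite /spec eqm (leg_colength_plateau eqm) exprS invfM.
by rewrite mulrCA [t * _]mulrA divff ?t_neq0 // mul1r.
Qed.

Lemma spec_adjacent_neq n (j : 'I_n) (mu : 'X_{1..n.+1}) :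
  spec mu (left_pos j) != spec mu (right_pos j).
Proof.
apply/eqP => e; have eqm := spec_exp e.
by case/indep: e => _; rewrite (leg_colength_plateau eqm) => /eqP;
  rewrite ltn_eqF.
Qed.

Lemma spec_Phi n (mu : 'X_{1..n.+1}) :
  spec (Phi mu) =1 fun i => q ^+ (i == ord_max) * spec mu (ordS i).
Proof.
move=> i; rewrite /spec leg_colength_Phi mnmE eqSS -val_eqE addnC exprD.
by rewrite mulrA.
Qed.

(** Hence the factor z_n - t^(1-n) of Phi vanishes at the spectral vectors that
    are not of the form [spec (Phi eta)]. *)
Lemma spec_last0 n (mu : 'X_{1..n.+1}) :
  (spec mu ord_max == t ^- n) = (mu ord_max == 0%N).
Proof.
apply/eqP/eqP => [e|h]; last first.
  by rewrite /spec h leg_colength_last0 // expr0 mul1r.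
by have [] := @indep (mu ord_max) (leg_colength mu ord_max) 0 n;
  rewrite // expr0 mul1r.
Qed.

Lemma spec_rcons0 n (mu : 'X_{1..n}) i : spec (rcons0 mu) i =
  if unlift ord_max i is Some j then spec mu j else t ^- n.
Proof.
case: unliftP => [j ->|->]; last by apply/eqP; rewrite spec_last0 rcons0_last.
by rewrite /spec rcons0_lift leg_colength_rcons0.
Qed.

(** The linear coordinates inverse to the action of Phi on spectral vectors. *)
Definition unrotate n (i : 'I_n.+1) : {mpoly K[n.+1]} :=
  q ^- (i == ord0) *: 'X_(ord_pred i).

Lemma ord_pred_max n (i : 'I_n.+1) : (ord_pred i == ord_max) = (i == ord0).
Proof.
rewrite -(inj_eq (@ordS_inj _)) ord_predK; congr (i == _).
by apply: val_inj; rewrite /= modnn.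
Qed.

Lemma unrotate_spec n (mu : 'X_{1..n.+1}) i :
  (unrotate i).@[spec (Phi mu)] = spec mu i.
Proof.
rewrite mevalZ mevalXU spec_Phi ord_predK ord_pred_max mulrA mulVf ?mul1r //.
by rewrite expf_neq0 ?q_neq0.
Qed.

Lemma msize_lin n (c : K) (i : 'I_n) : (msize (c *: 'X_i : {mpoly K[n]}) <= 2)%N.
Proof. by rewrite (leq_trans (msizeZ_le _ _)) // msizeX mdeg1. Qed.

(** Compositions ending in 0 have spectral vectors on the hyperplane z_n = t^(1-n),
    where they are those of one variable less: by induction on the number of
    variables [f] vanishes there, so [f] is z_n - t^(1-n) times some [h].  The
    remaining compositions are the [Phi eta]; at their vectors [h] vanishes, and
    after a linear change of variables these are the spectral vectors of modulus
    one less, so induction on the degree gives [h = 0]. *)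
Theorem interpolation_unique n e (f : {mpoly K[n]}) :
  (msize f <= e)%N ->
  (forall mu : 'X_{1..n}, (mdeg mu < e)%N -> f.@[spec mu] = 0) -> f = 0.
Proof.
elim: n e f => [|n IHn] e f.
  case: e => [|e] fe fv; first by apply/eqP; rewrite -msize_poly_eq0 -leqn0.
  have {fe} fC : f = (f@_0)%:MP.
    apply: msize1_polyC; rewrite msizeE; apply/bigmax_leqP_seq => m _ _.
    by rewrite mdegE big_ord0.
  have := fv 0%MM; rewrite mdeg0 => /(_ isT).
  by rewrite fC mevalC => ->; rewrite mpolyC0.
elim: e f => [|e IHe] f fe fv; first by apply/eqP; rewrite -msize_poly_eq0 -leqn0.
have c2 : (msize ((t ^- n)%:MP : {mpoly K[n.+1]}) <= 2)%N.
  by rewrite msizeC; case: eqP.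
have [h he fE] := mpoly_division ord_max c2 fe.
(* The restriction of f to the hyperplane, as a polynomial in one variable less. *)
have f0 : subst (fun i => if unlift ord_max i is Some j then 'X_j
                          else (t ^- n)%:MP) f = 0.
  apply: (IHn e.+1) => [|mu mue].
    apply: msize_subst => // i.
    by case: unlift => [j|]; rewrite ?msizeX ?mdeg1 // msizeC; case: eqP.
  rewrite meval_subst -[RHS](fv (rcons0 mu)) ?mdeg_rcons0 //.
  apply: meval_eq => i; rewrite spec_rcons0.
  by case: unlift => [j|]; rewrite ?mevalXU ?mevalC.
have {f0} f0 : subst (fun i => if i == ord_max then (t ^- n)%:MP else 'X_i) f = 0.
  have := congr1 (subst (fun j => 'X_(lift ord_max j))) f0.
  rewrite subst0 subst_subst => f0'; rewrite -[RHS]f0'.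
  apply: eq_subst => i; case: unliftP => [j ->|->]; last by rewrite eqxx substC.
  by rewrite substX eq_sym (negbTE (neq_lift _ _)).
rewrite {}f0 addr0 in fE.
suff h0 : h = 0 by rewrite fE h0 mulr0.
(* Pulling back along [rot] turns the values of h at the spec (Phi mu) into values
   at the spec mu. *)
pose rot i : {mpoly K[n.+1]} := q ^+ (i == ord_max) *: 'X_(ordS i).
have {}h0 : subst rot h = 0.
  apply: IHe => [|mu mue]; first by apply: msize_subst => // i; apply: msize_lin.
  have /eqP : f.@[spec (Phi mu)] = 0 by rewrite fv // mdeg_Phi.
  rewrite fE mevalM mevalB mevalXU mevalC mulf_eq0 subr_eq0 spec_last0.
  rewrite mnmE eqxx addn1 /= => /eqP <-; rewrite meval_subst.
  by apply: meval_eq => i; rewrite mevalZ mevalXU spec_Phi.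
have := congr1 (subst (@unrotate n)) h0.
rewrite subst_subst subst0 => <-.
rewrite subst_id // => i; rewrite /rot substZ substX.
rewrite /unrotate scalerA -ord_pred_max ordSK divff ?scale1r //.
by rewrite expf_neq0 ?q_neq0.
Qed.

(** * Hecke operators and the eigenvalue equation *)

(** The operator H_i, cleared of its denominator.  The value on z_i = 0 is stated
    separately, since the cleared identity gives none where z_i = z_(i+1) = 0. *)
Lemma hecke_operator n (j : 'I_n) d (f : {mpoly K[n.+1]}) :
  (msize f <= d.+1)%N ->
  exists2 g : {mpoly K[n.+1]}, (msize g <= d.+1)%N &
    (forall z, (z (left_pos j) - z (right_pos j)) * g.@[z] =
       (t - 1) * z (left_pos j) * f.@[z]
       + (z (left_pos j) - t * z (right_pos j)) * f.@[fun i => z (adj j i)])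
    /\ (forall z, z (left_pos j) = 0 -> g.@[z] = t * f.@[fun i => z (adj j i)]).
Proof.
move=> fd; set L := left_pos j; set R := right_pos j.
pose sf := subst (fun i => 'X_(adj j i)) f.
have sfE z : sf.@[z] = f.@[fun i => z (adj j i)].
  by rewrite meval_subst; apply: meval_eq => i; rewrite mevalXU.
have sfd : (msize sf <= d.+1)%N by apply: msize_subst => // i; rewrite msizeX mdeg1.
have R2 : (msize ('X_R : {mpoly K[n.+1]}) <= 2)%N by rewrite msizeX mdeg1.
have fsfd : (msize (f - sf) <= d.+1)%N by rewrite msizeD_bound // msizeN.
have [h hd hE] := mpoly_division L R2 fsfd.
have {}hE : f - sf = ('X_L - 'X_R) * h.
  rewrite hE -[RHS]addr0; congr (_ + _).
  rewrite /sf /subst comp_mpolyB -!/(subst _ _) subst_subst; apply/eqP.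
  rewrite subr_eq0; apply/eqP/eq_subst => i; rewrite substX.
  case: (adjP j i) => [->|->|i1 i2] //; rewrite -/L -/R eqxx.
    by case: eqP.
  by case: eqP.
exists ((t - 1) *: ('X_L * h) + t *: sf).
  apply: msizeD_bound; apply: leq_trans (msizeZ_le _ _) _ => //.
  by rewrite -[d.+1]add1n msizeM_bound // msizeX mdeg1.
split=> z => [|z0]; rewrite mevalD !mevalZ mevalM mevalXU sfE.
  have := congr1 (meval z) hE; rewrite mevalM !mevalB !mevalXU sfE => e.
  transitivity ((t - 1) * z L * ((z L - z R) * h.@[z])
    + (z L - z R) * (t * f.@[fun i => z (adj j i)])); first by ring.
  by rewrite -e; ring.
by rewrite z0 mul0r mulr0 add0r.
Qed.

(** The coordinates in places [a], ..., [a + m] are rotated by one place; the one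
    that goes round, and its image, are zero. *)
Definition cycled n a m (z w : 'I_n.+1 -> K) : Prop :=
  forall i : 'I_n.+1,
  [/\ i = a :> nat -> z i = 0, i = (a + m)%N :> nat -> w i = 0,
      (i < a)%N || (a + m < i)%N -> w i = z i
    & forall i' : 'I_n.+1, (a <= i < a + m)%N -> i' = i.+1 :> nat -> w i = z i'].

(** On the hyperplane where the leading variable is zero each Hecke operator is [t]
    times a transposition, and the transpositions compose to a rotation. *)
Lemma hecke_chain n (l : seq 'I_n) a m d (f : {mpoly K[n.+1]}) :
  map val l = iota a m -> (msize f <= d.+1)%N ->
  exists2 g : {mpoly K[n.+1]}, (msize g <= d.+1)%N &
    (forall mu, g.@[spec mu] != 0 ->
       exists A ka, mu = foldr (swap_if A) ka l /\ f.@[spec ka] != 0)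
    /\ (forall z w, cycled a m z w -> g.@[z] = t ^+ m * f.@[w]).
Proof.
move=> + fd; elim: l a m => [|j l IHl] a [|m] //=.
  move=> _; exists f => //; split=> [mu fmu|z w zw].
    by exists set0, mu.
  rewrite expr0 mul1r; apply: meval_eq => i; have [z0 w0 wE _] := zw i.
  have [ia|ia] := eqVneq (i : nat) a; first by rewrite z0 // w0 // addn0.
  by rewrite wE // addn0 -neq_ltn.
case=> ja /[dup] lE /IHl[g gd [gS gz]].
have [g' g'd [g'E g'0]] := hecke_operator j gd.
exists g' => //; split=> [mu|z w zw].
  move=> g'mu; have := g'E (spec mu).
  have [gmu _|gmu] := boolP (g.@[spec mu] != 0).
    (* The entries of l lie strictly above j, so the choice of A at j is free. *)
    have [A [ka [-> fka]]] := gS _ gmu; exists (A :\ j), ka; split=> //.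
    rewrite /swap_if setD11; apply: eq_foldr_swap => i il; rewrite !inE.
    case: eqP => // ij; move: il; rewrite {}ij => /(map_f val); rewrite lE mem_iota.
    by rewrite -ja ltnn.
  rewrite (eqP (negbNE gmu)) mulr0 add0r => e.
  have : (spec mu (left_pos j) - t * spec mu (right_pos j))
           * g.@[fun i => spec mu (adj j i)] != 0.
    by rewrite -e mulf_neq0 // subr_eq0 spec_adjacent_neq.
  rewrite mulf_eq0 negb_or subr_eq0 => /andP[ne].
  have {}ne : mu (left_pos j) != mu (right_pos j).
    by apply: contraNneq ne => /spec_plateau/eqP.
  rewrite -(meval_eq _ (spec_swap ne)) => /gS[A [ka [swE fka]]].
  exists (j |: A), ka; split=> //; rewrite /swap_if setU11 -[LHS](swapK j) swE.
  congr (swap j _); apply: eq_foldr_swap => i il; rewrite !inE.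
  case: eqP => // ij; move: il; rewrite {}ij => /(map_f val); rewrite lE mem_iota.
  by rewrite -ja ltnn.
have [z0 _ _ _] := zw (left_pos j).
rewrite g'0 ?z0 // (gz _ w) ?exprS ?mulrA // => i; split.
- move=> ia; rewrite (_ : i = right_pos j) ?adj_right ?z0 //.
  by apply: val_inj; rewrite /= ia -ja.
- by move=> ia; have [_ -> //] := zw i; rewrite ia addnS addSn.
- case: (adjP j i) => [->|->|i1 i2].
  + move=> _; have [_ _ _ /(_ (right_pos j)) -> //] := zw (left_pos j).
    by rewrite /= -ja addnS leqnn ltnS leq_addr.
  + by rewrite /= /bump /=; lia.
  + by move=> ia; have [_ _ -> //] := zw i; rewrite /= -ja in ia i1 *; lia.
- move=> i' /andP[ai im] ii'; have [_ _ _ /(_ i') ->] := zw i.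
  + by case: (adjP j i') => // e; move: ai; rewrite -ltnS -ii' e /= /bump /= -ja; lia.
  + by rewrite ltnW //= addnS -addSn.
  + exact: ii'.
Qed.

(** The raising operator: it multiplies by z_n - t^(1-n) after the change of
    coordinates [unrotate]. *)
Lemma phi_operator n d (f : {mpoly K[n.+1]}) : (msize f <= d.+1)%N ->
  exists2 g : {mpoly K[n.+1]}, (msize g <= d.+2)%N &
    (forall mu, g.@[spec mu] != 0 ->
       exists ka, mu = Phi ka /\ f.@[spec ka] != 0)
    /\ (forall z w : 'I_n.+1 -> K, z ord_max = 0 ->
          (forall i, w i = z (ord_pred i)) -> g.@[z] = - t ^- n * f.@[w]).
Proof.
move=> fd; exists (('X_ord_max - (t ^- n)%:MP) * subst (@unrotate n) f).
  rewrite -[d.+2]add1n msizeM_bound //; last by apply: msize_subst => // i; apply: msize_lin.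
  apply: msizeD_bound; first by rewrite msizeX mdeg1.
  by rewrite msizeN msizeC; case: eqP.
split=> [mu|z w z0 wz]; rewrite mevalM mevalB mevalXU mevalC meval_subst.
  rewrite mulf_eq0 negb_or subr_eq0 spec_last0 -lt0n => /andP[/PhiP[ka ->] fka].
  exists ka; split=> //; apply: contraNneq fka => <-.
  by apply/eqP/meval_eq => i; rewrite unrotate_spec.
rewrite z0 sub0r; congr (_ * _); apply: meval_eq => i.
rewrite mevalZ mevalXU wz; have [->|i0] := eqVneq i ord0; last first.
  by rewrite expr0 invr1 mul1r.
have -> : ord_pred ord0 = ord_max :> 'I_n.+1 by apply/eqP; rewrite ord_pred_max.
by rewrite z0 mulr0.
Qed.

(** The operator X_k. *)
Lemma D_operator n (k : 'I_n.+1) d (f : {mpoly K[n.+1]}) : (msize f <= d.+1)%N ->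
  exists2 g : {mpoly K[n.+1]}, (msize g <= d.+2)%N &
    (forall mu, g.@[spec mu] != 0 ->
       exists A ka, mu = DI A k ka /\ f.@[spec ka] != 0)
    /\ (forall z : 'I_n.+1 -> K, z k = 0 -> g.@[z] = - f.@[z]).
Proof.
move=> fd.
have [g1 g1d [g1S g1z]] := hecke_chain (positions_below k) fd.
have [g2 g2d [g2S g2z]] := phi_operator g1d.
have [g3 g3d [g3S g3z]] := hecke_chain (positions_above k) g2d.
exists g3 => //; split=> [mu|z zk].
  case/g3S=> A2 [ka2 [-> /g2S[ka1 [-> /g1S[A1 [ka [-> fka]]]]]]].
  (* The swaps before Phi lie below k, those after it at k or above. *)
  pose A := [set j : 'I_n | if (j < k)%N then j \in A1 else j \in A2].
  exists A, ka; split=> //; rewrite /DI.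
  rewrite (@eq_foldr_swap _ A A2) => [|j]; last first.
    by rewrite mem_filter inE leqNgt => /andP[/negbTE->].
  rewrite (@eq_foldr_swap _ A A1) // => j.
  by rewrite mem_filter inE => /andP[->].
(* The composite of the three coordinate shifts is the identity on the
   hyperplane z_k = 0, and the powers of t cancel. *)
pose w (i : 'I_n.+1) := if unlift ord_max i is Some i' then z (lift k i') else 0.
have wmax : w ord_max = 0 by rewrite /w unlift_none.
have wlift i : w (lift ord_max i) = z (lift k i) by rewrite /w liftK.
pose u i := w (ord_pred i).
have wE (i : 'I_n.+1) : i != n :> nat ->
    exists2 i', i = lift ord_max i' & i' = i :> nat.
  case: (unliftP ord_max i) => [i' -> _|->]; last by rewrite eqxx.
  by exists i'; rewrite ?lift_max.
have e3 : cycled k (n - k) z w.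
  have kn : (k <= n)%N by rewrite -ltnS.
  rewrite /cycled subnKC // => i; split.
  - by move/val_inj->.
  - by move=> h; rewrite (_ : i = ord_max) //; apply: val_inj.
  - have -> : (n < i)%N = false by rewrite ltnNge -ltnS ltn_ord.
    rewrite orbF => ik.
    have [|i' e i'E] := wE i; first by rewrite neq_ltn (leq_trans ik).
    by rewrite {1}e wlift; congr z; apply: ord_inj; rewrite /= /bump i'E leqNgt ik.
  - move=> i' /andP[ki im] ii'; have [|j e jE] := wE i; first by rewrite neq_ltn im.
    by rewrite e wlift; congr z; apply: ord_inj; rewrite /= /bump jE ki ii'.
have e1 : cycled 0 k u z.
  move=> i; split; rewrite ?add0n.
  - move=> i0; rewrite /u (_ : i = ord0); last exact: val_inj.
    have -> : ord_pred ord0 = ord_max :> 'I_n.+1 by apply/eqP; rewrite ord_pred_max.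
    by [].
  - by move/val_inj->.
  - rewrite ltn0 /= => ki.
    have := ordS_val (ord_pred i); rewrite ord_predK.
    case: eqP => [_ i0|/eqP/wE[i' e i'E] iS]; first by move: ki; rewrite i0.
    rewrite /u e wlift; congr z; apply: ord_inj; rewrite /= /bump i'E iS.
    by move: ki; rewrite iS ltnS => ->.
  - move=> i' /= ik ii'; have -> : i' = ordS i.
      apply: ord_inj; rewrite ordS_val ii'; case: eqP => // e.
      by have := leq_trans ik (leq_ord k); rewrite e ltnn.
    rewrite /u ordSK; have [|j e jE] := wE i.
      by rewrite neq_ltn (leq_trans ik) // -ltnS.
    by rewrite {2}e wlift; congr z; apply: ord_inj; rewrite /= /bump jE leqNgt ik.
rewrite (g3z _ w) // (g2z _ u) // (g1z _ z) //.
transitivity (- (t ^+ (n - k) * t ^+ k * t ^- n * f.@[z])); first by ring.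
by rewrite -exprD subnK ?leq_ord // divff ?mul1r // expf_neq0 ?t_neq0.
Qed.

(** The eigenvalue equation (1).  Dividing [g + f] by ['X_k] yields a polynomial
    of degree at most that of [f]; it agrees with [f / spec la k] at the
    interpolation points because [g] vanishes there: [g] is supported on
    compositions [DI A k ka] with [f] nonzero at [ka], and those have modulus
    greater than that of [la]. *)
Lemma D_eigenfunction n (k : 'I_n.+1) (la : 'X_{1..n.+1}) (f : {mpoly K[n.+1]}) :
  (msize f <= (mdeg la).+1)%N ->
  (forall mu : 'X_{1..n.+1}, mu <> la -> (mdeg mu <= mdeg la)%N -> f.@[spec mu] = 0) ->
  exists2 g : {mpoly K[n.+1]}, (msize g <= (mdeg la).+2)%N &
    (forall mu, g.@[spec mu] != 0 ->
       exists A ka, mu = DI A k ka /\ f.@[spec ka] != 0)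
    /\ (forall z : 'I_n.+1 -> K, g.@[z] = (z k / spec la k - 1) * f.@[z]).
Proof.
move=> fd fv; have [g gd [gS gz]] := D_operator k fd.
exists g => //; split=> //.
have gfd : (msize (g + f) <= (mdeg la).+2)%N by rewrite msizeD_bound // ltnW.
have z2 : (msize (0 : {mpoly K[n.+1]}) <= 2)%N by rewrite msize0.
have [xi xid xiE] := mpoly_division k z2 gfd.
have {}xiE z : g.@[z] + f.@[z] = z k * xi.@[z].
  rewrite -mevalD xiE mevalD mevalM subr0 mevalXU meval_subst mevalD gz ?addNr ?addr0 //.
  by rewrite eqxx meval0.
have xi_eq : xi = (spec la k)^-1 *: f.
  apply/eqP; rewrite -subr_eq0; apply/eqP.
  apply: (@interpolation_unique _ (mdeg la).+1).
    by rewrite msizeD_bound // msizeN (leq_trans (msizeZ_le _ _)).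
  move=> mu; rewrite ltnS => mud; apply: (mulfI (spec_neq0 mu k)).
  rewrite mevalB mevalZ mulr0 mulrBr -xiE.
  have -> : g.@[spec mu] = 0.
    apply/eqP/negPn/negP => /gS[A [ka [muE]]]; rewrite fv ?eqxx //.
      by move=> kala; move: mud; rewrite muE mdeg_DI kala ltnn.
    by apply: leq_trans mud; rewrite muE mdeg_DI.
  rewrite add0r; have [->|/eqP mula] := eqVneq mu la.
    by rewrite mulrA divff ?spec_neq0 // mul1r subrr.
  by rewrite fv // !mulr0 subrr.
move=> z; rewrite mulrBl mul1r; apply/eqP; rewrite eq_sym subr_eq eq_sym xiE.
by rewrite xi_eq mevalZ mulrA.
Qed.

(** Some spectral coordinate [k] separates [mu] from [la], and then the eigenvalue
    equation for [k] passes from [mu] to a composition of modulus one less. *)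
Lemma extra_vanishing n (la : 'X_{1..n.+1}) (f : {mpoly K[n.+1]}) :
  (msize f <= (mdeg la).+1)%N ->
  (forall mu : 'X_{1..n.+1}, mu <> la -> (mdeg mu <= mdeg la)%N -> f.@[spec mu] = 0) ->
  forall mu, f.@[spec mu] != 0 -> preceq' la mu.
Proof.
move=> fd fv mu; have [m] := ubnP (mdeg mu); elim: m mu => // m IHm mu mum fmu.
have [->|ne] := eqVneq mu la; first exact: preceq'_refl.
have /existsP[k kne] : [exists k, spec mu k != spec la k].
  apply: contraNT ne; rewrite negb_exists => /forallP h; apply/eqP/spec_inj => k.
  by have := h k; rewrite negbK => /eqP.
have [g gd [gS gE]] := D_eigenfunction k fd fv.
have /gS[A [ka [muE fka]]] : g.@[spec mu] != 0.
  rewrite gE mulf_neq0 // subr_eq0 -[1](divff (spec_neq0 la k)).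
  by rewrite (inj_eq (mulIf _)) // invr_neq0 // spec_neq0.
apply: (@preceq'_trans _ _ ka); last by rewrite muE preceq'_DI.
by apply: IHm => //; move: mum; rewrite muE mdeg_DI ltnS.
Qed.

Section PieriFormula.
Variables (n : nat) (E : 'X_{1..n.+1} -> {mpoly K[n.+1]}).
Hypothesis E_size : forall mu, (msize (E mu) <= (mdeg mu).+1)%N.
Hypothesis E_vanish : forall mu nu : 'X_{1..n.+1},
  nu <> mu -> (mdeg nu <= mdeg mu)%N -> (E mu).@[spec nu] = 0.
Hypothesis E_coeff : forall mu, (E mu)@_mu = 1.

(** Otherwise [E mu] would vanish at a set of points that determines the polynomials
    of its degree, contrary to its coefficient 1. *)
Lemma E_spec_neq0 mu : (E mu).@[spec mu] != 0.
Proof.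
apply/eqP => e; have /eqP := E_coeff mu; rewrite (_ : E mu = 0) ?mcoeff0.
  by rewrite eq_sym oner_eq0.
apply: interpolation_unique (E_size mu) _ => nu nud.
by have [->|/eqP ne] := eqVneq nu mu; [exact: e|exact: E_vanish].
Qed.

(** Both sides have degree at most [mdeg la + 1] and agree at the spectral vectors
    of modulus at most [mdeg la + 1]; outside [D k la] both vanish there, the left
    side by the support of X_k E_la. *)
Lemma linear_pieri (k : 'I_n.+1) (la : 'X_{1..n.+1}) z :
  (z k / spec la k - 1) * (E la).@[z] =
  \sum_(nu <- D k la) (spec nu k / spec la k - 1)
     * ((E la).@[spec nu] / (E nu).@[spec nu]) * (E nu).@[z].
Proof.
have [g gd [gS gE]] := D_eigenfunction k (E_size la) (@E_vanish la).
pose c nu := (spec nu k / spec la k - 1) * ((E la).@[spec nu] / (E nu).@[spec nu]).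
have degD nu : nu \in D k la -> mdeg nu = (mdeg la).+1.
  by case/mem_D=> A ->; rewrite mdeg_DI.
suff gsum : g = \sum_(nu <- D k la) c nu *: E nu.
  by rewrite -gE gsum raddf_sum /=; apply: eq_bigr => nu _; rewrite mevalZ.
apply/eqP; rewrite -subr_eq0; apply/eqP.
apply: (@interpolation_unique _ (mdeg la).+2).
  rewrite msizeD_bound // msizeN big_seq.
  apply: (big_ind (fun p => msize p <= _)%N); rewrite ?msize0 //.
    by move=> p p'; apply: msizeD_bound.
  by move=> nu /degD <-; rewrite (leq_trans (msizeZ_le _ _)).
move=> mu; rewrite ltnS => mud; apply/eqP; rewrite mevalB subr_eq0 raddf_sum /=.
have [muD|muD] := boolP (mu \in D k la).
  rewrite (bigD1_seq mu) ?undup_uniq //= big_seq_cond big1 => [|nu /andP[nuD numu]].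
    by rewrite addr0 mevalZ gE /c mulrA mulfVK ?E_spec_neq0.
  by rewrite mevalZ E_vanish ?mulr0 ?(degD _ nuD) //; apply/eqP; rewrite eq_sym.
rewrite big_seq big1 => [|nu nuD]; last first.
  rewrite mevalZ E_vanish ?mulr0 ?(degD _ nuD) // => munu.
  by move: muD; rewrite munu nuD.
apply: contraNT muD => /gS[A [ka [muE Eka]]]; apply/mem_D; exists A.
rewrite muE; congr DI; apply/eqP; apply: contraNT Eka => /eqP kala.
by rewrite E_vanish // -ltnS -(mdeg_DI A k) -muE.
Qed.

Theorem pieri_formula (k : 'I_n.+1) (la mu : 'X_{1..n.+1}) :
  spec mu k / spec la k - 1 != 0 ->
  (E la).@[spec mu] =
  \sum_(nu <- D k la | preceq' nu mu)
     (spec nu k / spec la k - 1) / (spec mu k / spec la k - 1)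
     * ((E la).@[spec nu] / (E nu).@[spec nu]) * (E nu).@[spec mu].
Proof.
move=> den; apply: (mulfI den); rewrite linear_pieri big_distrr /=.
rewrite [RHS]big_mkcond; apply: eq_bigr => nu _; case: ifP => [_|numu].
  move: den (spec nu k / spec la k - 1); move: (_ - 1) => x x0 y.
  by rewrite -!mulrA [RHS]mulrCA (mulVKf x0).
have -> : (E nu).@[spec mu] = 0; last by rewrite mulr0.
apply: contraFeq numu => /(extra_vanishing (E_size nu)); apply.
exact: E_vanish.
Qed.

End PieriFormula.
End GenericParameters.

(** * The field Q(q, t) *)

Lemma Qqt_t_neq0 : t != 0.
Proof. by rewrite /t tofrac_eq0 -msize_poly_eq0 msizeX. Qed.

Lemma clear_denominators (F : fieldType) (x y : F) a b c d :
  y != 0 -> x ^+ a * y ^- b = x ^+ c * y ^- d ->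
  x ^+ a * y ^+ d = x ^+ c * y ^+ b.
Proof. by move=> y0 /eqP; rewrite eqr_div ?expf_neq0 // => /eqP. Qed.

Lemma mpolyX_inj (R : nzRingType) n (a b : 'X_{1..n}) :
  'X_[a] = 'X_[b] :> {mpoly R[n]} -> a = b.
Proof.
move=> /(congr1 (mcoeff a)); rewrite !mcoeffX eqxx; case: eqP => // _ /eqP.
by rewrite oner_eq0.
Qed.

(** Distinct monomials in two indeterminates are distinct elements of the fraction
    field. *)
Lemma qt_indep a b c d : q ^+ a * t ^- b = q ^+ c * t ^- d -> a = c /\ b = d.
Proof.
move/(clear_denominators Qqt_t_neq0).
rewrite /q /t -!tofracXn -!tofracM => /eqP; rewrite tofrac_eq.
rewrite !mpolyXn -!mpolyXD => /eqP/mpolyX_inj/mnmP e.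
move: (e ord0) (e ord_max); rewrite !mnmDE !mulmnE !mnm1E !eqxx /=.
by rewrite !mul1n !mul0n !addn0 !add0n => -> ->.
Qed.

Theorem proposition8 (n : nat)
    (E : 'X_{1..n.+1} -> {mpoly Qqt[n.+1]})
    (hE : forall mu : 'X_{1..n.+1}, is_interpolation_Macdonald mu (E mu))
    (eta : 'X_{1..n.+1}) (i j : nat) (hij : (i < j - 1)%N)
    (lami lamj : 'X_{1..n.+1})
    (hlami : mdeg lami = (mdeg eta + i)%N)
    (hlamj : mdeg lamj = (mdeg eta + j)%N)
    (hlam : preceq' lami lamj)
    (k : 'I_n.+1) (hk : leftmost_freq_diff lami lamj k)
    (hden : spectral lamj k * (spectral lami k)^-1 - 1 != 0) :
  (E lami).@[spectral lamj] =
  \sum_(nu <- D k lami | preceq' nu lamj)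
     (spectral nu k * (spectral lami k)^-1 - 1)
       / (spectral lamj k * (spectral lami k)^-1 - 1)
     * ((E lami).@[spectral nu] / (E nu).@[spectral nu])
     * (E nu).@[spectral lamj].
Proof.
have E_size mu : (msize (E mu) <= (mdeg mu).+1)%N by case: (hE mu).
have E_vanish mu nu : nu <> mu -> (mdeg nu <= mdeg mu)%N ->
    (E mu).@[spectral nu] = 0 by case: (hE mu) => _ + _; apply.
have E_coeff mu : (E mu)@_mu = 1 by case: (hE mu).
exact: (pieri_formula qt_indep E_size E_vanish E_coeff hden).
Qed.
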